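(* Let $\Sigma$ be an alphabet. A language $\mathcal{L}\subseteq\Sigma^{**}$ is accepted by some nondeterministic ordinal automaton (NOA) over $\Sigma$ if and only if $\mathcal{L}$ belongs to $\mathrm{REG}^{\infty}$.
   Context: An alphabet $\Sigma$ is a finite set; $\Sigma^{**}=\Sigma^{<\mathrm{On}}$ denotes the class of all sequences of ordinal length over $\Sigma$, with concatenation $w_1w_2$. A DOA is a quintuple $(Q,q_0,F,D,\Sigma)$ with $Q$ a set, $q_0\in Q$, $F\subseteq Q$, and $D$ a partial class function $Q\times\Sigma^{**}\to Q$ such that for all $q\in Q$ and $w,w_1,w_2\in\Sigma^{**}$ with $w=w_1w_2$: if $D(q,w)$ is defined then $D(q,w_1)$ is defined and $D(D(q,w_1),w_2)=D(q,w)$. Its accepted language is $S(\mathcal{A})=\{w: D(q_0,w)\text{ defined and }\in F\}$; $\mathcal{L}$ is $\mathrm{REG}^{\infty}$ if $\mathcal{L}=S(\mathcal{A})$ for some DOA $\mathcal{A}$. An NOA is a quintuple $(Q,q_0,F,D,\Sigma)$ with $Q$ a set, $q_0\in Q$, $F\subseteq Q$ and $D\subseteq Q\times\Sigma^{**}\times Q$ a class relation; write $D(q,w)=\{q':(q,w,q')\in D\}$ and $D[X,w]=\bigcup_{q\in X}D(q,w)$ for $X\subseteq Q$; it is required that $D[D(q,w_1),w_2]=D(q,w_1w_2)$ for all $q\in Q$, $w_1,w_2\in\Sigma^{**}$. The NOA accepts $S(\mathcal{A})=\{w\in\Sigma^{**}: D(q_0,w)\cap F\neq\emptyset\}$.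
   Formalization: The DOA condition is read as: if D(q,w1w2) is defined then so is D(q,w1), and D(D(q,w1),w2)=D(q,w1w2) as partial values (each side defined iff the other is); if the equation is required only when D(q,w) is defined, the equivalence fails. *)

(* Defs.v *)
From HB Require Import structures.
From mathcomp Require Import all_boot.
From mathcomp Require Import boolp classical_sets wochoice.

Set Implicit Arguments.
Unset Strict Implicit.
Unset Printing Implicit Defensive.

Local Open Scope classical_set_scope.
Local Open Scope quotient_scope.

(* The universe of "sets".  Both the state sets of automata and the carriers of
   the well-orders representing ordinals live in this one universe, whereas the
   words form a type of the next universe, that is, a proper class: no state
   set is large enough to enumerate the words, or the ordinals. *)
Definition small := Type.

(* A sequence of ordinal length over Sigma is represented by a well-order whose
   elements carry letters; isomorphic ones are identified below. *)
Record preword (Sigma : finType) := Preword {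
  pw_pos : small;
  pw_le : rel pw_pos;
  pw_wo : well_order pw_le;
  pw_lab : pw_pos -> Sigma }.

HB.instance Definition _ (Sigma : finType) :=
  Choice.copy (preword Sigma) {classic (preword Sigma)}.

Section Words.
Variable Sigma : finType.
Implicit Types u v : preword Sigma.

Definition pw_iso u v : Prop :=
  exists f : pw_pos u -> pw_pos v,
    [/\ bijective f, {mono f : x y / pw_le x y >-> pw_le x y}
      & forall x, pw_lab (f x) = pw_lab x].

Definition pw_eq : rel (preword Sigma) := fun u v => `[< pw_iso u v >].

Lemma pw_iso_refl u : pw_iso u u.
Proof. by exists id; split=> //; exists id. Qed.

Lemma pw_iso_sym u v : pw_iso u v -> pw_iso v u.
Proof.
case=> f [[g fK gK] fle flab]; exists g; split; first by exists f.
- by move=> x y; rewrite -fle !gK.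
- by move=> x; rewrite -flab gK.
Qed.

Lemma pw_iso_trans v u w : pw_iso u v -> pw_iso v w -> pw_iso u w.
Proof.
move=> [f [fbij fle flab]] [g [gbij gle glab]]; exists (g \o f); split.
- exact: bij_comp.
- by move=> x y /=; rewrite gle fle.
- by move=> x /=; rewrite glab flab.
Qed.

Lemma pw_eq_refl : reflexive pw_eq.
Proof. by move=> u; apply/asboolP; apply: pw_iso_refl. Qed.

Lemma pw_eq_sym : symmetric pw_eq.
Proof. by move=> u v; apply/asboolP/asboolP; apply: pw_iso_sym. Qed.

Lemma pw_eq_trans : transitive pw_eq.
Proof.
by move=> v u w /asboolP uv /asboolP vw; apply/asboolP; apply: pw_iso_trans vw.
Qed.

Canonical pw_equiv := EquivRel pw_eq pw_eq_refl pw_eq_sym pw_eq_trans.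

Definition word := {eq_quot pw_equiv}.
HB.instance Definition _ : EqQuotient _ pw_equiv word := EqQuotient.on word.
HB.instance Definition _ := Choice.on word.

Definition pw_cat_le u v : rel (pw_pos u + pw_pos v) := fun a b =>
  match a, b with
  | inl x, inl y => pw_le x y
  | inl _, inr _ => true
  | inr _, inl _ => false
  | inr x, inr y => pw_le x y
  end.

Lemma pw_cat_wo u v : well_order (@pw_cat_le u v).
Proof.
move=> A [a Aa].
have [[x Ax]|noL] := pselect (exists x, inl x \in A).
  have [|z [[Az zmin] zuniq]] := @pw_wo _ u [pred x | inl x \in A].
    by exists x.
  exists (inl z); split.
    by split=> // -[y|y] //= Ay; apply: zmin.
  move=> [y|y] [Ay ymin]; last by have := ymin _ Ax.
  by congr inl; apply: zuniq; split=> // t At; apply: (ymin (inl t)).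
case: a Aa => [x|x] Ax; first by case: noL; exists x.
have [|z [[Az zmin] zuniq]] := @pw_wo _ v [pred x | inr x \in A].
  by exists x.
exists (inr z); split.
  split=> // -[y|y] Ay; last exact: zmin.
  by case: noL; exists y.
move=> [y|y] [Ay ymin]; first by case: noL; exists y.
by congr inr; apply: zuniq; split=> // t At; apply: (ymin (inr t)).
Qed.

Definition pw_cat u v : preword Sigma :=
  Preword (@pw_cat_wo u v)
    (fun a => match a with inl x => pw_lab x | inr x => pw_lab x end).

Definition catw (w1 w2 : word) : word :=
  \pi_word (pw_cat (repr w1) (repr w2)).

Lemma pw_cat_iso u u' v v' :
  pw_iso u u' -> pw_iso v v' -> pw_iso (pw_cat u v) (pw_cat u' v').
Proof.
move=> [f [[f' fK f'K] fle flab]] [g [[g' gK g'K] gle glab]].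
exists (fun a => match a with inl x => inl (f x) | inr x => inr (g x) end).
split.
- exists (fun a => match a with inl x => inl (f' x) | inr x => inr (g' x) end).
    by case=> x; rewrite ?fK ?gK.
  by case=> x; rewrite ?f'K ?g'K.
- by move=> [x|x] [y|y] //=.
- by case=> x /=.
Qed.

Lemma pw_iso_repr u : pw_iso (repr (\pi_word u)) u.
Proof. by apply/asboolP; apply/(@eqquotP _ pw_equiv word); rewrite reprK. Qed.

Lemma catw_pi u v : catw (\pi_word u) (\pi_word v) = \pi_word (pw_cat u v).
Proof.
by apply/eqquotP/asboolP/pw_cat_iso; apply: pw_iso_repr.
Qed.

Definition language := set word.

(* D(q, w) = None means that D is undefined at (q, w).  The equation
   D(D(q, w1), w2) = D(q, w1 w2) is an equality of partial values: each side
   is defined exactly when the other one is. *)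
Record DOA := MkDOA {
  doa_state : small;
  doa_init : doa_state;
  doa_final : set doa_state;
  doa_D : doa_state -> word -> option doa_state;
  doa_prefix : forall q w1 w2,
    doa_D q (catw w1 w2) <> None -> doa_D q w1 <> None;
  doa_comp : forall q q1 w1 w2,
    doa_D q w1 = Some q1 -> doa_D q1 w2 = doa_D q (catw w1 w2) }.

Definition doa_language (A : DOA) : language :=
  [set w | exists2 q, doa_D (doa_init A) w = Some q & doa_final q].

Definition REGinf : set language :=
  [set L | exists A : DOA, L = doa_language A].

(* D q w is the set D(q, w) of the successors of q, and ext_D D X w is
   D[X, w]. *)
Definition ext_D (Q : Type) (D : Q -> word -> set Q) (X : set Q) (w : word) :
  set Q := \bigcup_(q in X) D q w.

Record NOA := MkNOA {
  noa_state : small;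
  noa_init : noa_state;
  noa_final : set noa_state;
  noa_D : noa_state -> word -> set noa_state;
  noa_comp : forall q w1 w2,
    ext_D noa_D (noa_D q w1) w2 = noa_D q (catw w1 w2) }.

Definition noa_language (A : NOA) : language :=
  [set w | noa_D (noa_init A) w `&` @noa_final A !=set0].

End Words.

(* Main.v *)
(* An NOA is determinized by the powerset construction, which survives
   transfinite words because D[D(q, w1), w2] = D(q, w1 w2) is an axiom of NOAs
   rather than a consequence of reading letters one at a time.  Conversely, the
   graph of the transition function of a DOA is an NOA; prefix-definedness is
   what yields the inclusion of D(q, w1 w2) in D[D(q, w1), w2]. *)
Require Import Defs.
From mathcomp Require Import all_boot.
From mathcomp Require Import boolp classical_sets.

Set Implicit Arguments.
Unset Strict Implicit.
Unset Printing Implicit Defensive.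

Local Open Scope classical_set_scope.

Section Determinization.
Variables (Sigma : finType) (A : NOA Sigma).

(* The subset automaton is total: the empty set of states plays the role of a
   sink, so that [None] never occurs. *)
Definition subset_D (X : set (noa_state A)) (w : word Sigma) :
  option (set (noa_state A)) := Some (ext_D (@noa_D _ A) X w).

Lemma subset_prefix X w1 w2 :
  subset_D X (catw w1 w2) <> None -> subset_D X w1 <> None.
Proof. by []. Qed.

(** [ext_D] is a union over starting states, so [noa_comp], an axiom about single states, passes to
    sets state by state. *)
Lemma subset_comp X Y w1 w2 :
  subset_D X w1 = Some Y -> subset_D Y w2 = subset_D X (catw w1 w2).
Proof.
case=> <-; congr Some; apply/seteqP; split=> q'.
  move=> [q1 [q Xq Dq1] Dq']; exists q => //.
  by rewrite -noa_comp; exists q1.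
move=> [q Xq]; rewrite -noa_comp => -[q1 Dq1 Dq'].
by exists q1 => //; exists q.
Qed.

(* [noa_state A -> Prop] rather than [set (noa_state A)]: the universe of [set]
   must also accommodate sets of words, so it lies strictly above [small]. *)
Definition subset_automaton : DOA Sigma :=
  @MkDOA Sigma (noa_state A -> Prop) [set noa_init A]
    [set X | X `&` @noa_final _ A !=set0] subset_D subset_prefix subset_comp.

(** The run starts in a singleton, so the union collapses to [noa_D (noa_init A) w]. *)
Lemma subset_automaton_language : doa_language subset_automaton = noa_language A.
Proof.
apply/seteqP; split=> w; rewrite /doa_language /noa_language /=.
  by move=> [X [<-]]; rewrite /ext_D bigcup_set1.
by move=> Aw; exists (noa_D (noa_init A) w); rewrite // /subset_D /ext_D bigcup_set1.
Qed.

End Determinization.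

Section Graph.
Variables (Sigma : finType) (A : DOA Sigma).

(** Undefinedness becomes an empty successor set. *)
Definition graph_D (q : doa_state A) (w : word Sigma) : set (doa_state A) :=
  [set q' | doa_D q w = Some q'].

Lemma graph_comp q w1 w2 :
  ext_D graph_D (graph_D q w1) w2 = graph_D q (catw w1 w2).
Proof.
rewrite /ext_D /graph_D; apply/seteqP; split=> q' /=.
  by move=> [q1 /= /doa_comp ->].
move=> Dq'; case Dq1: (doa_D q w1) => [q1|].
  by exists q1 => //=; rewrite (doa_comp _ Dq1).
(* No intermediate state would mean an undefined prefix of a defined run. *)
by have /doa_prefix : doa_D q (catw w1 w2) <> None by rewrite Dq'.
Qed.

Definition graph_automaton : NOA Sigma :=
  @MkNOA Sigma (doa_state A) (doa_init A) (@doa_final _ A) graph_D graph_comp.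

Lemma graph_automaton_language : noa_language graph_automaton = doa_language A.
Proof. by apply/seteqP; split=> w [q] => [[]|]; exists q. Qed.

End Graph.

Theorem theorem2p5 (Sigma : finType) (L : language Sigma) :
  (exists A : NOA Sigma, L = noa_language A) <-> REGinf L.
Proof.
split=> -[A ->].
  by exists (subset_automaton A); rewrite subset_automaton_language.
by exists (graph_automaton A); rewrite graph_automaton_language.
Qed.
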